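(* Let $n\ge0$. For each $1\le q<r_n$, the paths $\mathcal{S}_n(q)$ and $\mathcal{S}_n(q+1)$ differ in at most $5$ places, and $d(\Phi_n(q),\Phi_n(q+1))\le 5$.
   Context: A Schröder path from $(0,0)$ to $(2n,0)$ is a lattice path using steps $\mathsf{u}=(1,1)$, $\mathsf{d}=(1,-1)$, $\mathsf{e}=(2,0)$ never going below the $x$-axis, written as a word in $\mathsf{u},\mathsf{d},\mathsf{e}$. Large Schröder numbers: $r_0=1$, $r_n=r_{n-1}+\sum_{k=1}^n r_{k-1}r_{n-k}$. Let $B(1)=0$, $B(i)=r_0+\cdots+r_{i-2}$ for $i>1$. For a list $\mathcal{S}_n$, $\mathcal{S}_n(j)$ is its $j$-th entry, and $\mathcal{S}_n^i(j)=\mathcal{S}_n(j)$ if $i$ is odd, $\mathcal{S}_n^i(j)=\mathcal{S}_n(r_n+1-j)$ if $i$ is even. With $\bigoplus$ denoting concatenation of lists in index order (outer index slowest), $\mathcal{S}_0=(\emptyset)$ and for $n\ge1$ $$\mathcal{S}_n=\bigoplus_{i=1}^{r_{n-1}}\big(\mathsf{e}\,\mathcal{S}_{n-1}(i)\big)\oplus\bigoplus_{i=1}^{n}\bigoplus_{j=1}^{r_{i-1}}\bigoplus_{k=1}^{r_{n-i}}\big(\mathsf{u}\,\mathcal{S}_{i-1}^{\,n+i}(j)\,\mathsf{d}\,\mathcal{S}_{n-i}^{\,j+B(i)+1}(k)\big).$$ The number of places in which two paths differ is computed after replacing each $\mathsf{e}$ by $\mathsf{r}\mathsf{r}$ (where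 $\mathsf{r}=(1,0)$), making both words of length $2n$, and counting the positions where the letters differ. For permutations $\sigma,\tau$ of the same length, $d(\sigma,\tau)$ is the number of positions in which they differ. The map $\varphi$ from Schröder paths $p$ from $(0,0)$ to $(2n,0)$ to permutations of $\{1,\ldots,n+1\}$ is defined as follows. For $i\ge1$, $s_i$ acting on a permutation $\pi$ exchanges the entries $\pi_i$ and $\pi_{i+1}$; a product of such $s$'s acts by applying its rightmost factor first. Step 1: for all integers $a,m$ with $0\le a,m<n$, place a dot at the point $((8m+1)/4,(8a+5)/4)$ and/or $((8m+5)/4,(8a+1)/4)$ whenever that point lies in the region beneath $p$ and above the $x$-axis; a dot at $(x,y)$ receives the label $s_i$ with $i=(1+x-y)/2$. Set $j=1$. Step 2: choose the rightmost dot with no line yet associated with it (label $s_k$); draw a horizontal line from it to the leftmost dot that can be reached without crossing $p$ (label $s_l$); set $\sigma_j=s_ks_{k-1}\cdots s_l$. If all dots now lie on lines, go to Step 3; otherwise increase $j$ by one and repeat Step 2. Step 3: $\varphi(p)=\sigma_j\cdots\sigma_2\sigma_1\,(n+1,n,\ldots,1)$. Finally $\Phi_n(j):=\varphi(\mathcal{S}_n(j))$. *)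

(* Defs.v *)
From HB Require Import structures.
From mathcomp Require Import all_boot all_fingroup zify.

Set Implicit Arguments.
Unset Strict Implicit.
Unset Printing Implicit Defensive.

(* [u] = (1,1), [d] = (1,-1), [e] = (2,0). *)
Inductive step := StepU | StepD | StepE.

Definition step_eqb (a b : step) : bool :=
  match a, b with
  | StepU, StepU | StepD, StepD | StepE, StepE => true
  | _, _ => false
  end.

Lemma step_eqP : Equality.axiom step_eqb.
Proof. by case; case; constructor. Qed.

HB.instance Definition _ := hasDecEq.Build step step_eqP.

(* Unit-width letters: [u], [d], and [r] = (1,0), half of an [e]. *)
Inductive letter := LetU | LetD | LetR.

Definition letter_eqb (a b : letter) : bool :=
  match a, b with
  | LetU, LetU | LetD, LetD | LetR, LetR => true
  | _, _ => false
  end.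

Lemma letter_eqP : Equality.axiom letter_eqb.
Proof. by case; case; constructor. Qed.

HB.instance Definition _ := hasDecEq.Build letter letter_eqP.

Definition path_word := seq step.

Definition letters (c : step) : seq letter :=
  match c with
  | StepU => [:: LetU]
  | StepD => [:: LetD]
  | StepE => [:: LetR; LetR]
  end.

Definition expand (p : path_word) : seq letter := flatten (map letters p).

Definition count_letter (a : letter) (w : seq letter) : nat := count_mem a w.

(* The truncated subtraction is harmless: heights are only compared in the form
   y < height w with y a natural number. *)
Definition height (w : seq letter) : nat :=
  count_letter LetU w - count_letter LetD w.

Definition is_schroder_path (n : nat) (p : path_word) : bool :=
  let w := expand p in
  [&& size w == n.*2,
      count_letter LetU w == count_letter LetD w &
      all (fun k => count_letter LetD (take k w) <= count_letter LetU (take k w))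
          (iota 0 (size w).+1)].

(* The number of places in which two paths (of equal length) differ. *)
Definition path_diff (p q : path_word) : nat :=
  count (fun ab => ab.1 != ab.2) (zip (expand p) (expand q)).

(* [schroder_seq n] is [:: r_0; ...; r_n]; see [schroderS] for the recurrence. *)
Fixpoint schroder_seq (n : nat) : seq nat :=
  if n is m.+1 then
    let t := schroder_seq m in
    rcons t (nth 0 t m +
             sumn [seq nth 0 t k.-1 * nth 0 t (m.+1 - k) | k <- iota 1 m.+1])
  else [:: 1].

Definition schroder (n : nat) : nat := nth 0 (schroder_seq n) n.

Definition offset (i : nat) : nat := sumn [seq schroder k | k <- iota 0 i.-1].

(* Lists are indexed from 1: [entry T m i j] is the j-th entry of [T m] if [i]
   is odd, and its (r_m + 1 - j)-th entry if [i] is even. *)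
Definition entry (T : nat -> seq path_word) (m i j : nat) : path_word :=
  nth [::] (T m) (if odd i then j else schroder m + 1 - j).-1.

Definition schroder_list_step (T : nat -> seq path_word) (n : nat) :
    seq path_word :=
  [seq StepE :: nth [::] (T n.-1) i.-1 | i <- iota 1 (schroder n.-1)] ++
  flatten [seq
    flatten [seq
      [seq StepU :: entry T i.-1 (n + i) j ++
           StepD :: entry T (n - i) (j + offset i + 1) k
         | k <- iota 1 (schroder (n - i))]
      | j <- iota 1 (schroder i.-1)]
    | i <- iota 1 n].

Fixpoint schroder_lists (n : nat) : seq (seq path_word) :=
  if n is m.+1 then
    let t := schroder_lists m in rcons t (schroder_list_step (nth [::] t) n)
  else [:: [:: [::]]].

(* The list S_n; see [schroder_listS] for the recurrence. *)
Definition schroder_list (n : nat) : seq path_word :=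
  nth [::] (schroder_lists n) n.

Definition schroder_path_at (n j : nat) : path_word :=
  nth [::] (schroder_list n) j.-1.

(* In the construction of phi, the plane is scaled by 4, so that a dot at
   (x/4, y/4) is the pair of naturals (x, y).  [quarter_height p t] is 4 times
   the height of [p] at abscissa t/4; since [p] is affine between consecutive
   multiples of 1/4, a horizontal segment joining two dots at height y/4 stays
   beneath [p] iff y < quarter_height p t for all integers t along it.  No dot
   ever lies on the path itself. *)
Definition quarter_height (p : path_word) (t : nat) : nat :=
  height (take t (flatten [seq nseq 4 l | l <- expand p])).

Definition dot := (nat * nat)%type.

Definition beneath (p : path_word) (D : dot) : bool :=
  (0 < D.2) && (D.2 < quarter_height p D.1).

Definition dots (n : nat) (p : path_word) : seq dot :=
  [seq D <- flatten [seq [:: (8 * m + 1, 8 * a + 5); (8 * m + 5, 8 * a + 1)]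
                    | a <- iota 0 n, m <- iota 0 n]
  | beneath p D].

(* i = (1 + x/4 - y/4) / 2; the division is exact on dots. *)
Definition label (D : dot) : nat := (4 + D.1 - D.2) %/ 8.

(* [on_line D1 D2 D]: D lies on the horizontal segment from D1 leftwards to D2. *)
Definition on_line (D1 D2 D : dot) : bool :=
  (D.2 == D1.2) && (D2.1 <= D.1 <= D1.1).

Definition reachable (p : path_word) (D1 D2 : dot) : bool :=
  [&& D2.2 == D1.2, D2.1 <= D1.1 &
      all (fun t => beneath p (t, D1.2)) (iota D2.1 (D1.1 - D2.1).+1)].

Definition leftmost (D0 : dot) (s : seq dot) : dot :=
  foldl (fun D D' => if D'.1 < D.1 then D' else D) D0 s.

Definition rightmost (D0 : dot) (s : seq dot) : dot :=
  foldl (fun D D' => if D.1 < D'.1 then D' else D) D0 s.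

(* [sigmas fuel p ds rem] lists sigma_1, sigma_2, ..., each s_k s_(k-1) ... s_l
   being the sequence of its indices; [ds] are all the dots of [p], and [rem]
   those not yet on a line.  Distinct lines end on the right at distinct
   abscissae, so the rightmost remaining dot is unique.  Each round removes at
   least one dot from [rem], so that fuel [size rem] is enough. *)
Fixpoint sigmas (fuel : nat) (p : path_word) (ds rem : seq dot) :
    seq (seq nat) :=
  match fuel, rem with
  | f.+1, D0 :: rem' =>
      let D1 := rightmost D0 rem' in
      let D2 := leftmost D1 [seq D <- ds | reachable p D1 D] in
      rev (iota (label D2) ((label D1).+1 - label D2)) ::
        sigmas f p ds [seq D <- rem | ~~ on_line D1 D2 D]
  | _, _ => [::]
  end.

(* Permutations of {1, ..., n+1} are represented on {0, ..., n}, positions and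
   values both shifted by 1: [s i pi] exchanges the entries of [pi] in positions
   i and i+1 (counted from 1; the labels satisfy 1 <= i <= n).  In MathComp
   (s * t) x = t (s x). *)
Definition act_s (n i : nat) (pi : 'S_n.+1) : 'S_n.+1 :=
  (tperm (inord i.-1) (inord i) * pi)%g.

(* The rightmost factor acts first. *)
Definition act_word (n : nat) (w : seq nat) (pi : 'S_n.+1) : 'S_n.+1 :=
  foldr (@act_s n) pi w.

(* The permutation (n+1, n, ..., 1). *)
Definition decreasing_perm (n : nat) : 'S_n.+1 := perm (@rev_ord_inj n.+1).

Definition phi (n : nat) (p : path_word) : 'S_n.+1 :=
  let ds := dots n p in
  act_word (flatten (rev (sigmas (size ds) p ds ds))) (decreasing_perm n).

Definition Phi (n j : nat) : 'S_n.+1 := phi n (schroder_path_at n j).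

Definition perm_diff (n : nat) (s t : 'S_n) : nat := #|[set i | s i != t i]|.

Lemma size_schroder_seq n : size (schroder_seq n) = n.+1.
Proof. by elim: n => //= n IH; rewrite size_rcons IH. Qed.

Lemma nth_schroder_seq n k : k <= n -> nth 0 (schroder_seq n) k = schroder k.
Proof.
elim: n => [|n IH]; first by case: k.
rewrite leq_eqVlt => /orP[/eqP->//|lt_kn].
by rewrite [schroder_seq _]/= nth_rcons size_schroder_seq lt_kn IH.
Qed.

Lemma schroder_seqS n :
  schroder_seq n.+1 = rcons (schroder_seq n) (nth 0 (schroder_seq n) n +
    sumn [seq nth 0 (schroder_seq n) k.-1 * nth 0 (schroder_seq n) (n.+1 - k)
         | k <- iota 1 n.+1]).
Proof. by []. Qed.

Lemma schroder0 : schroder 0 = 1.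
Proof. by []. Qed.

Lemma schroderS n :
  schroder n.+1 = schroder n +
    \sum_(1 <= k < n.+2) schroder k.-1 * schroder (n.+1 - k).
Proof.
rewrite {1}/schroder schroder_seqS nth_rcons size_schroder_seq ltnn eqxx.
congr (_ + _); rewrite sumnE big_map.
rewrite (_ : index_iota 1 n.+2 = iota 1 n.+1) //; apply: eq_big_seq => k.
by rewrite mem_iota => kn; rewrite !nth_schroder_seq //; lia.
Qed.

Lemma offsetE i : offset i = \sum_(0 <= k < i.-1) schroder k.
Proof. by rewrite /offset sumnE big_map /index_iota subn0. Qed.

Lemma size_schroder_lists n : size (schroder_lists n) = n.+1.
Proof. by elim: n => //= n IH; rewrite size_rcons IH. Qed.

Lemma nth_schroder_lists n k :
  k <= n -> nth [::] (schroder_lists n) k = schroder_list k.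
Proof.
elim: n => [|n IH]; first by case: k.
rewrite leq_eqVlt => /orP[/eqP->//|lt_kn].
by rewrite [schroder_lists _]/= nth_rcons size_schroder_lists lt_kn IH.
Qed.

Lemma schroder_listsS n :
  schroder_lists n.+1 = rcons (schroder_lists n)
    (schroder_list_step (nth [::] (schroder_lists n)) n.+1).
Proof. by []. Qed.

Lemma schroder_list0 : schroder_list 0 = [:: [::]].
Proof. by []. Qed.

Lemma schroder_listS n :
  schroder_list n.+1 = schroder_list_step schroder_list n.+1.
Proof.
rewrite {1}/schroder_list schroder_listsS nth_rcons size_schroder_lists.
rewrite ltnn eqxx /schroder_list_step nth_schroder_lists //; congr (_ ++ flatten _).
apply/eq_in_map => i; rewrite mem_iota => /andP[i0 le_in].
congr flatten; apply: eq_map => j; apply: eq_map => k; rewrite /entry.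
by rewrite !nth_schroder_lists //; lia.
Qed.

Lemma size_schroder_list n : size (schroder_list n) = schroder n.
Proof.
case: n => // n; rewrite schroder_listS /schroder_list_step size_cat size_map.
rewrite size_iota schroderS; congr (_ + _).
rewrite size_flatten /shape -map_comp sumnE big_map /index_iota subn1.
apply: eq_bigr => i _ /=; rewrite size_flatten /shape -map_comp.
rewrite (eq_map (g := fun=> schroder (n.+1 - i))) => [|j /=]; last first.
  by rewrite size_map size_iota.
by rewrite sumnE big_map big_const_seq count_predT size_iota iter_addn_0 mulnC.
Qed.

Lemma entry_in n i j :
  0 < j <= schroder n -> entry schroder_list n i j \in schroder_list n.
Proof.
case/andP=> j0 jn; rewrite /entry mem_nth // size_schroder_list.
by case: odd; lia.
Qed.

Lemma schroder_path_at_in n j :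
  0 < j <= schroder n -> schroder_path_at n j \in schroder_list n.
Proof. by case/andP=> j0 jn; rewrite mem_nth // size_schroder_list prednK. Qed.

Lemma count_letter_cons a b w :
  count_letter a (b :: w) = (b == a) + count_letter a w.
Proof. by []. Qed.

Lemma count_letter_cat a w1 w2 :
  count_letter a (w1 ++ w2) = count_letter a w1 + count_letter a w2.
Proof. exact: count_cat. Qed.

Lemma is_schroder_pathP n p :
  reflect [/\ size (expand p) = n.*2,
             count_letter LetU (expand p) = count_letter LetD (expand p) &
             forall k, count_letter LetD (take k (expand p)) <=
                       count_letter LetU (take k (expand p))]
          (is_schroder_path n p).
Proof.
apply: (iffP and3P) => [[/eqP sz /eqP bal /allP pre]|[-> -> pre]]; split=> //.
- move=> k; have [le_k|/ltnW le_k] := leqP k (size (expand p)).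
    by apply: pre; rewrite mem_iota.
  by rewrite take_oversize // bal.
- by apply/allP=> k _; exact: pre.
Qed.

Lemma is_schroder_path_flat n p :
  is_schroder_path n p -> is_schroder_path n.+1 (StepE :: p).
Proof.
case/is_schroder_pathP=> sz bal pre; apply/is_schroder_pathP.
rewrite (_ : expand (StepE :: p) = LetR :: LetR :: expand p) //= sz !add0n bal.
by split=> // -[|[|k]] //=; rewrite !add0n.
Qed.

Lemma is_schroder_path_arch m n p q :
  is_schroder_path m p -> is_schroder_path n q ->
  is_schroder_path (m + n).+1 (StepU :: p ++ StepD :: q).
Proof.
case/is_schroder_pathP=> szp balp prep /is_schroder_pathP[szq balq preq].
have eE : expand (StepU :: p ++ StepD :: q) =
    LetU :: expand p ++ LetD :: expand q by rewrite /expand /= map_cat flatten_cat.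
apply/is_schroder_pathP; rewrite eE /= size_cat /= szp szq.
rewrite !(count_letter_cons, count_letter_cat) balp balq !eqE /=.
split; [lia|lia|case=> [|k] //=]; rewrite take_cat.
case: ltnP => _; first by have := prep k; lia.
rewrite !count_letter_cat balp; case: (k - _) => [|l] /=; first lia.
by have := preq l; lia.
Qed.

Lemma schroder_list_paths n p : p \in schroder_list n -> is_schroder_path n p.
Proof.
elim/ltn_ind: n p => -[|n] IH p; first by rewrite mem_seq1 => /eqP->.
rewrite schroder_listS mem_cat => /orP[/mapP[i]|/flatten_mapP[i]].
  rewrite mem_iota => /andP[i0 ir] ->; apply: is_schroder_path_flat.
  by apply: IH => //; apply: schroder_path_at_in; rewrite i0.
rewrite mem_iota => /andP[i0 le_in] /flatten_mapP[j].
rewrite mem_iota => /andP[j0 jr] /mapP[k]; rewrite mem_iota => /andP[k0 kr] ->.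
have := @is_schroder_path_arch i.-1 (n.+1 - i)
  (entry schroder_list i.-1 (n.+1 + i) j)
  (entry schroder_list (n.+1 - i) (j + offset i + 1) k).
rewrite (_ : (i.-1 + (n.+1 - i)).+1 = n.+1); last lia.
by apply; apply: IH; try lia; apply: entry_in; lia.
Qed.

(* Main.v *)
(* Each arch u p1 d of a path p, with up step at (X, Y) and p1 of semilength a,
   carries exactly one line of dots, with labels l, ..., l + a where
   l = (X - Y)/2 + 1, and the lines are drawn in right-to-left order of their
   down steps.  Hence phi is computed recursively: e p keeps the first entry and
   acts as p on the others; u p1 d p2 lets p2 act on the last |p2| + 1 entries,
   then moves the first entry |p1| + 1 places to the right, then lets p1 act on
   the first |p1| + 1 entries.  So replacing p1 or p2 by a neighbour changes no
   more letters, and no more entries, than the replacement itself does.  Since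
   the inner lists are read alternately forwards and backwards, the only other
   transitions are e p -> u d p, and u x_a d y_(b+1) -> u x_(a+1) d y_b with x_m
   and y_m the first path e^m or the last path u e^(m-1) d of S_m; as e^m acts
   trivially and u e^(m-1) d by a rotation, these are checked directly. *)

Require Import Defs.
From mathcomp Require Import all_boot all_fingroup.
From mathcomp Require Import zify.

Set Implicit Arguments.
Unset Strict Implicit.
Unset Printing Implicit Defensive.

(** * Schröder paths as trees *)

Inductive spath := Nil | Flat of spath | Arch of spath & spath.

Fixpoint semilength (t : spath) : nat :=
  match t with
  | Nil => 0
  | Flat t => (semilength t).+1
  | Arch t1 t2 => (semilength t1 + semilength t2).+1
  end.

Fixpoint word (t : spath) : path_word :=
  match t with
  | Nil => [::]
  | Flat t => StepE :: word t
  | Arch t1 t2 => StepU :: word t1 ++ StepD :: word t2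
  end.

(** The tree is read off the recurrence of the lists rather than by parsing a word at its first
    return to the axis. *)
Lemma schroder_list_word n p :
  p \in schroder_list n -> exists2 t, semilength t = n & word t = p.
Proof.
elim/ltn_ind: n p => -[|n] IH p; first by rewrite mem_seq1 => /eqP->; exists Nil.
rewrite schroder_listS mem_cat => /orP[/mapP[i]|/flatten_mapP[i]].
  rewrite mem_iota => /andP[i0 ir] ->.
  have [|t <- <-] := IH n (leqnn _) (nth [::] (schroder_list n) i.-1).
    by apply: schroder_path_at_in; rewrite i0.
  by exists (Flat t).
rewrite mem_iota => /andP[i0 le_in] /flatten_mapP[j].
rewrite mem_iota => /andP[j0 jr] /mapP[k]; rewrite mem_iota => /andP[k0 kr] ->.
have lt1 : i.-1 < n.+1 by lia.
have lt2 : n.+1 - i < n.+1 by lia.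
have [|t1 sz1 <-] := IH _ lt1 (entry schroder_list i.-1 (n.+1 + i) j).
  by apply: entry_in; lia.
have [|t2 sz2 <-] :=
  IH _ lt2 (entry schroder_list (n.+1 - i) (j + offset i + 1) k).
  by apply: entry_in; lia.
by exists (Arch t1 t2) => //=; lia.
Qed.

(** * Arches and dots *)

(* [(X, a, Y)] stands for an up step starting at [(X, Y)] whose matching down
   step starts at [(X + 2 a + 1, Y + 1)]. *)
Definition arch := (nat * nat * nat)%type.

(* In right-to-left order of the down steps, as in the construction of phi. *)
Fixpoint arches (X Y : nat) (t : spath) : seq arch :=
  match t with
  | Nil => [::]
  | Flat t => arches X.+2 Y t
  | Arch t1 t2 =>
      arches (X + (semilength t1).*2.+2) Y t2 ++
      (X, semilength t1, Y) :: arches X.+1 Y.+1 t1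
  end.

(** The last two facts say that the climb never exceeds the distance travelled and has its parity.
    For a path from the origin, the half-difference [(x - y)./2] in a label is therefore exact and
    untruncated. *)
Lemma arches_bounds X Y t x a y : (x, a, y) \in arches X Y t ->
  [/\ X <= x, x + a.*2.+2 <= X + (semilength t).*2, Y <= y,
      y + X <= x + Y & odd (x + y) = odd (X + Y)].
Proof.
elim: t X Y => [|t IH|t1 IH1 t2 IH2] X Y //=.
  by case/IH => *; split; lia.
rewrite mem_cat in_cons => /or3P[/IH2|/eqP[-> -> ->]|/IH1].
- by case=> *; split; lia.
- by split; lia.
- by case=> *; split; lia.
Qed.

(** The first conjunct makes the right ends of the lines move strictly leftwards; the second keeps
    strips at equal height disjoint, so that no dot lies on two lines. *)
Definition arch_before (L L' : arch) : bool :=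
  let: (x, a, y) := L in let: (x', a', y') := L' in
  (x' + a'.*2 < x + a.*2) && ((y != y') || (x' + a'.*2.+2 <= x)).

Lemma arches_pairwise X Y t : pairwise arch_before (arches X Y t).
Proof.
elim: t X Y => [|t IH|t1 IH1 t2 IH2] X Y //=.
rewrite pairwise_cat IH2 /= IH1 andbT; apply/andP; split.
  apply/allrelP => -[[x a] y] -[[x' a'] y'] /arches_bounds[].
  move=> h1 h2 h3 h4 h5; rewrite in_cons => /orP[/eqP[-> -> ->]|/arches_bounds[]];
  move=> *; rewrite /arch_before; lia.
apply/allP => -[[x a] y] /arches_bounds[] *; rewrite /arch_before; lia.
Qed.

(** * Heights of a path at quarter abscissas *)

Definition quarters (t : spath) : seq letter :=
  flatten [seq nseq 4 l | l <- expand (word t)].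

Lemma expand_arch t1 t2 : expand (word (Arch t1 t2)) =
  LetU :: expand (word t1) ++ LetD :: expand (word t2).
Proof. by rewrite /expand /= map_cat flatten_cat. Qed.

Lemma quarters_arch t1 t2 : quarters (Arch t1 t2) =
  nseq 4 LetU ++ quarters t1 ++ nseq 4 LetD ++ quarters t2.
Proof.
by rewrite /quarters expand_arch [map _ _]/= map_cat /= flatten_cat.
Qed.

Lemma size_expand_word t : size (expand (word t)) = (semilength t).*2.
Proof.
elim: t => [|t IH|t1 IH1 t2 IH2] //; first by rewrite /= IH.
by rewrite expand_arch /= size_cat /= IH1 IH2; lia.
Qed.

Lemma size_quarters t : size (quarters t) = 8 * semilength t.
Proof.
rewrite size_flatten /shape -map_comp.
rewrite (eq_map (g := fun=> 4)) //.
by rewrite sumnE big_map big_const_seq count_predT iter_addn_0 size_expand_word; lia.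
Qed.

Definition prefix_count (l : letter) (k : nat) (w : seq letter) : nat :=
  count_letter l (take k w).

Lemma prefix_count_cat l k w1 w2 : prefix_count l k (w1 ++ w2) =
  prefix_count l k w1 + prefix_count l (k - size w1) w2.
Proof.
rewrite /prefix_count take_cat; case: ltnP => [lt_k|le_k].
  by rewrite (eqP (ltnW lt_k)) take0 /= addn0.
by rewrite count_letter_cat (take_oversize le_k).
Qed.

Lemma prefix_count_nseq l k m l' :
  prefix_count l k (nseq m l') = (l' == l) * minn k m.
Proof.
rewrite /prefix_count /count_letter.
have [le_k|/ltnW le_m] := leqP k m; first by rewrite take_nseq // count_nseq.
by rewrite take_oversize ?size_nseq // count_nseq.
Qed.

Lemma prefix_count0 l w : prefix_count l 0 w = 0.
Proof. by rewrite /prefix_count take0. Qed.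

Lemma prefix_count_flat l k t : l != LetR ->
  prefix_count l k (quarters (Flat t)) = prefix_count l (k - 8) (quarters t).
Proof.
move=> lR; rewrite (_ : quarters (Flat t) = nseq 8 LetR ++ quarters t) //.
by rewrite prefix_count_cat prefix_count_nseq size_nseq eq_sym (negPf lR).
Qed.

Lemma prefix_count_archU k t1 t2 : prefix_count LetU k (quarters (Arch t1 t2)) =
  minn k 4 + prefix_count LetU (k - 4) (quarters t1) +
  prefix_count LetU (k - 8 - 8 * semilength t1) (quarters t2).
Proof.
rewrite quarters_arch !prefix_count_cat !prefix_count_nseq !size_nseq.
rewrite size_quarters mul1n mul0n add0n addnA; congr (_ + _ + prefix_count _ _ _).
by lia.
Qed.

Lemma prefix_count_archD k t1 t2 : prefix_count LetD k (quarters (Arch t1 t2)) =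
  prefix_count LetD (k - 4) (quarters t1) +
  minn (k - 4 - 8 * semilength t1) 4 +
  prefix_count LetD (k - 8 - 8 * semilength t1) (quarters t2).
Proof.
rewrite quarters_arch !prefix_count_cat !prefix_count_nseq !size_nseq.
rewrite size_quarters mul1n mul0n add0n addnA; congr (_ + _ + prefix_count _ _ _).
by lia.
Qed.

Lemma prefix_count_le k t :
  prefix_count LetD k (quarters t) <= prefix_count LetU k (quarters t).
Proof.
elim: t k => [|t IH|t1 IH1 t2 IH2] k //.
  by rewrite !prefix_count_flat.
rewrite prefix_count_archU prefix_count_archD.
by have := IH1 (k - 4); have := IH2 (k - 8 - 8 * semilength t1); lia.
Qed.

Lemma prefix_count_balanced k t : 8 * semilength t <= k ->
  prefix_count LetD k (quarters t) = prefix_count LetU k (quarters t).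
Proof.
elim: t k => [|t IH|t1 IH1 t2 IH2] k //= le_k.
  by rewrite !prefix_count_flat // IH //; lia.
rewrite prefix_count_archU prefix_count_archD IH1 ?IH2; lia.
Qed.

(** In quarter units the up step meets height [4 * Y + 1] at [4 * X + 1], and the down step meets it
    at [4 * (X + a.*2) + 7]; the bounds exclude these two points of the path. *)
Definition covers (x h : nat) (L : arch) : bool :=
  let: (X, a, Y) := L in (h == Y) && (4 * X + 2 <= x <= 4 * (X + a.*2) + 6).

Lemma has_covers_out X Y t x h :
    x <= 4 * X + 1 \/ 4 * X + 8 * semilength t - 1 <= x \/ h < Y ->
  has (covers x h) (arches X Y t) = false.
Proof.
move=> out; apply/hasP => -[[[x' a] y] /arches_bounds[h1 h2 h3 h4 h5]].
by rewrite /covers; lia.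
Qed.

(* Only the points at a quarter above an integral height are considered; there
   the path is the boundary of the union of the strips of the arches. *)
Lemma beneath_arches X Y t x h : 4 * X <= x -> Y <= h ->
  (4 * h + 1 + prefix_count LetD (x - 4 * X) (quarters t) <
     4 * Y + prefix_count LetU (x - 4 * X) (quarters t)) =
  has (covers x h) (arches X Y t).
Proof.
elim: t X Y => [|t IH|t1 IH1 t2 IH2] X Y leX leY.
- by rewrite /prefix_count /=; lia.
- rewrite !prefix_count_flat //=; have [le_x|lt_x] := leqP (4 * X.+2) x.
    by rewrite -IH // (_ : x - 4 * X - 8 = x - 4 * X.+2); last lia.
  rewrite has_covers_out; last lia.
  by rewrite (_ : x - 4 * X - 8 = 0) ?prefix_count0; lia.
rewrite prefix_count_archU prefix_count_archD /= has_cat /=.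
set a := semilength t1.
have [gt_x|le_x] := ltnP (4 * X + 8 * a + 8) x.
  (* Right of the arch, [t1] is balanced and only [t2] contributes. *)
  rewrite (@prefix_count_balanced _ t1); last lia.
  rewrite (has_covers_out (X := X.+1)); last lia.
  rewrite -IH2; [|lia|lia].
  rewrite (_ : x - 4 * X - 8 - 8 * a = x - 4 * (X + a.*2.+2)); last lia.
  by rewrite /covers; lia.
rewrite (has_covers_out (X := X + a.*2.+2)); last lia.
rewrite (_ : x - 4 * X - 8 - 8 * a = 0) ?prefix_count0; last lia.
(* Here [t2] has not begun: at [h = Y] only the outer arch matters, and above it only the arches of
   [t1]. *)
have [->|neq_h] := eqVneq h Y.
  rewrite (has_covers_out (Y := Y.+1)); last lia.
  have := prefix_count_le (x - 4 * X - 4) t1.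
  have [lt_x|ge_x] := ltnP x (4 * X + 4).
    rewrite (_ : x - 4 * X - 4 = 0) ?prefix_count0; last lia.
    by rewrite /covers; lia.
  have [ge2|lt2] := leqP (8 * a) (x - 4 * X - 4).
    by rewrite prefix_count_balanced // /covers; lia.
  by rewrite /covers; lia.
have [lt_x|ge_x] := ltnP x (4 * X + 4).
  rewrite (has_covers_out (X := X.+1)); last lia.
  rewrite (_ : x - 4 * X - 4 = 0) ?prefix_count0; last lia.
  by rewrite /covers; lia.
have [ge2|lt2] := leqP (8 * a) (x - 4 * X - 4).
  rewrite prefix_count_balanced // (has_covers_out (X := X.+1)); last lia.
  by rewrite /covers; lia.
rewrite -IH1; [|lia|lia].
rewrite (_ : x - 4 * X.+1 = x - 4 * X - 4); last lia.
by rewrite /covers; lia.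
Qed.

Lemma beneath_word t x h :
  beneath (word t) (x, 4 * h + 1) = has (covers x h) (arches 0 0 t).
Proof.
rewrite -beneath_arches // muln0 subn0 /beneath /quarter_height /height.
by rewrite -/(quarters t) -!/(prefix_count _ _ _) /=; lia.
Qed.

(** * Lines of dots *)

Definition arch_left (L : arch) : dot := (4 * L.1.1 + 5, 4 * L.2 + 1).

Definition arch_right (L : arch) : dot :=
  (4 * (L.1.1 + L.1.2.*2) + 5, 4 * L.2 + 1).

Definition on_arch (D : dot) (L : arch) : bool :=
  on_line (arch_right L) (arch_left L) D.

(** The two families of dots, with [h] odd and [h] even respectively, merge into a single
    congruence. *)
Lemma mem_dots n p D : D \in dots n p -> beneath p D /\
  exists h, D.2 = 4 * h + 1 /\ D.1 = 4 * h + 5 %[mod 8].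
Proof.
rewrite mem_filter => /andP[-> /flattenP[s /allpairsP[[a m] /= [_ _ ->]]]] inD.
split=> //; move: inD; rewrite !inE => /orP[] /eqP-> /=.
  by exists (2 * a + 1); lia.
by exists (2 * a); lia.
Qed.

Lemma arch_beneath t X a Y x : (X, a, Y) \in arches 0 0 t ->
  4 * X + 2 <= x <= 4 * (X + a.*2) + 6 -> beneath (word t) (x, 4 * Y + 1).
Proof.
by move=> inL xL; rewrite beneath_word; apply/hasP; exists (X, a, Y); rewrite //= eqxx.
Qed.

Lemma arch_dots t X a Y k : (X, a, Y) \in arches 0 0 t -> k <= a ->
  (4 * X + 5 + 8 * k, 4 * Y + 1) \in dots (semilength t) (word t).
Proof.
move=> inL le_k; rewrite mem_filter (arch_beneath inL) /=; last lia.
have [_ h1 _ h2 h3] := arches_bounds inL.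
(* [X] and [Y] have the same parity; the dot is the first of this pair when they are odd, the second
   when they are even. *)
apply/flattenP; exists [:: (8 * ((X + 1)./2 + k) + 1, 8 * Y./2 + 5);
                          (8 * ((X + 1)./2 + k) + 5, 8 * Y./2 + 1)].
  apply/allpairsP; exists (Y./2, (X + 1)./2 + k).
  by split=> //=; rewrite mem_iota /=; lia.
by rewrite !inE !xpair_eqE; lia.
Qed.

Lemma dots_on_arch t D : D \in dots (semilength t) (word t) ->
  has (on_arch D) (arches 0 0 t).
Proof.
case: D => x y /mem_dots[ben [h /= [eq_y eq_x]]].
move: ben; rewrite eq_y beneath_word => /hasP[[[X a] Y] inL /= /andP[/eqP-> xL]].
have [_ _ _ h2 h3] := arches_bounds inL.
by apply/hasP; exists (X, a, Y) => //; rewrite /on_arch /on_line /= eqxx; lia.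
Qed.

Lemma rightmostP D0 s : rightmost D0 s \in D0 :: s /\
  {in D0 :: s, forall D, D.1 <= (rightmost D0 s).1}.
Proof.
rewrite /rightmost; elim: s D0 => [|D1 s IH] D0 /=.
  by rewrite mem_seq1 eqxx; split=> // D; rewrite mem_seq1 => /eqP->.
set D2 := if _ then _ else _; have [inD maxD] := IH D2; split.
  move: inD; rewrite !in_cons /D2; case: ifP => _ /orP[/eqP->|->];
  by rewrite ?eqxx ?orbT.
have le2 := maxD D2 (mem_head _ _).
move=> D; rewrite !in_cons => /or3P[/eqP->|/eqP->|inDs].
- by apply: leq_trans le2; rewrite /D2; case: ifP => // /ltnW.
- by apply: leq_trans le2; rewrite /D2; case: ifP => // /negbT; rewrite -leqNgt.
by apply: maxD; rewrite in_cons inDs orbT.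
Qed.

Lemma leftmostP D0 s : leftmost D0 s \in D0 :: s /\
  {in D0 :: s, forall D, (leftmost D0 s).1 <= D.1}.
Proof.
rewrite /leftmost; elim: s D0 => [|D1 s IH] D0 /=.
  by rewrite mem_seq1 eqxx; split=> // D; rewrite mem_seq1 => /eqP->.
set D2 := if _ then _ else _; have [inD minD] := IH D2; split.
  move: inD; rewrite !in_cons /D2; case: ifP => _ /orP[/eqP->|->];
  by rewrite ?eqxx ?orbT.
have le2 := minD D2 (mem_head _ _).
move=> D; rewrite !in_cons => /or3P[/eqP->|/eqP->|inDs].
- by apply: leq_trans le2 _; rewrite /D2; case: ifP => // /ltnW.
- by apply: leq_trans le2 _; rewrite /D2; case: ifP => // /negbT; rewrite -leqNgt.
by apply: minD; rewrite in_cons inDs orbT.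
Qed.

(** Within the arch the segment stays beneath the path, so the left dot is reachable; going further
    left would cross the up step of [L]. *)
Lemma leftmost_reachable t L :
    let ds := dots (semilength t) (word t) in
    L \in arches 0 0 t ->
  leftmost (arch_right L) [seq D <- ds | reachable (word t) (arch_right L) D] =
  arch_left L.
Proof.
case: L => -[X a] Y /= inL; set R := arch_right _; set s := filter _ _.
have [inD minD] := leftmostP R s.
have le_l : (leftmost R s).1 <= 4 * X + 5.
  apply: (minD (4 * X + 5, 4 * Y + 1)); rewrite in_cons mem_filter.
  have := arch_dots inL (leq0n a); rewrite muln0 addn0 => ->.
  rewrite andbT; apply/orP; right; apply/and3P; split; [by []|rewrite /=; lia|].
  by apply/allP => x; rewrite mem_iota /= => xL; apply: (arch_beneath inL); lia.
move: inD le_l; case: (leftmost R s) => x y.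
rewrite in_cons => /orP[/eqP[-> ->]|] /=.
  by rewrite /arch_left /= => le_l; congr (_, _); lia.
rewrite mem_filter => /andP[/and3P[/eqP /= eq_y lexR /andP[_ /allP bx]] /mem_dots[_]].
case=> h /= [eq_h eq_x] le_l; rewrite eq_y /arch_left /=.
congr (_, _); apply/eqP.
have {}eq_h : h = Y by lia.
subst h; apply: contraT => neq_x.
have [_ _ _ h2 h3] := arches_bounds inL.
(* By the congruence a dot further left has abscissa at most [4 * X - 3], so the segment would
   contain this point of the up step. An arch covering it would overlap [L] at the same height,
   against [arch_before]. *)
have : beneath (word t) (4 * X + 1, 4 * Y + 1).
  by apply: bx; rewrite mem_iota; lia.
rewrite beneath_word => /hasP[[[X' a'] Y'] inL' /= /andP[/eqP eqY xL']].
move: inL inL'; have := arches_pairwise 0 0 t.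
move: (arches 0 0 t) => ls; elim: ls => //= L ls IH /andP[/allP bef pw].
rewrite !in_cons => /orP[/eqP eqL|inL] /orP[/eqP eqL'|inL'].
- by move: eqL; rewrite -eqL' => -[] *; lia.
- by have := bef _ inL'; rewrite -eqL /=; lia.
- by have := bef _ inL; rewrite -eqL' /=; lia.
- exact: IH.
Qed.

Definition arch_word (L : arch) : seq nat :=
  rev (iota ((L.1.1 - L.2)./2.+1) L.1.2.+1).

(** Strict maximality of [R] makes the choice of the rightmost dot independent of the order of
    [rem]. *)
Lemma sigmasS f p ds rem R : R \in rem ->
    {in rem, forall D, D.1 <= R.1 ?= iff (D == R)} ->
  sigmas f.+1 p ds rem =
    let D2 := leftmost R [seq D <- ds | reachable p R D] in
    rev (iota (label D2) ((label R).+1 - label D2)) ::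
      sigmas f p ds [seq D <- rem | ~~ on_line R D2 D].
Proof.
case: rem => [|D0 rem] // inR maxR /=.
have -> // : rightmost D0 rem = R.
have [inR' maxR'] := rightmostP D0 rem; apply/eqP.
by rewrite -(maxR _ inR') eqn_leq (maxR _ inR') maxR'.
Qed.

Lemma label_arch t L : L \in arches 0 0 t ->
  label (arch_left L) = (L.1.1 - L.2)./2.+1 /\
  label (arch_right L) = (L.1.1 - L.2)./2.+1 + L.1.2.
Proof.
case: L => -[X a] Y /arches_bounds[_ _ _ h2 h3].
by rewrite /label /arch_left /arch_right /=; lia.
Qed.

(** Invariant of the drawing process: after the arches of [pre] have received their lines, the
    remaining dots are exactly those on the arches of [ls]. *)
Lemma sigmas_arches t pre ls fuel :
    let ds := dots (semilength t) (word t) in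
    let rem := [seq D <- ds | has (on_arch D) ls] in
    arches 0 0 t = pre ++ ls -> size rem <= fuel ->
  sigmas fuel (word t) ds rem = map arch_word ls.
Proof.
move=> ds; elim: ls pre fuel => [|L ls IH] pre fuel rem eq_ls.
  by rewrite /rem (eq_filter (a2 := pred0)) // filter_pred0; case: fuel.
have inL : L \in arches 0 0 t by rewrite eq_ls mem_cat mem_head orbT.
have pw : all (arch_before L) ls.
  by have := arches_pairwise 0 0 t; rewrite eq_ls pairwise_cat /= => /and4P[].
have in_right : arch_right L \in rem.
  rewrite mem_filter /= {1}/on_arch /on_line eqxx leqnn /=.
  case: L inL {eq_ls pw rem} => -[X a] Y inL.
  have := arch_dots inL (leqnn a); rewrite /arch_right /=.
  rewrite (_ : 4 * X + 5 + 8 * a = 4 * (X + a.*2) + 5) => [->|]; lia.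
have max_right D : D \in rem -> D.1 <= (arch_right L).1 ?= iff (D == arch_right L).
  rewrite mem_filter /= => /andP[/orP[] + _]; move: pw {in_right eq_ls inL rem}.
    case: L D => -[X a] Y [x y] _; rewrite /on_arch /on_line /= /arch_right.
    by case/andP=> /eqP-> xL; split; [lia | rewrite xpair_eqE eqxx andbT /=].
  move=> /allP bef /hasP[L' inL' onL']; have := bef _ inL'.
  case: L L' D inL' onL' {bef} => -[X a] Y [[X' a'] Y'] [x y] _.
  rewrite /on_arch /on_line /= /arch_right.
  by case/andP=> /eqP-> xL; split; [lia | rewrite xpair_eqE /=; lia].
(* Disjointness of the strips: drawing the line of [L] removes no dot of a later arch. *)
have eq_rem : [seq D <- rem | ~~ on_line (arch_right L) (arch_left L) D] =
    [seq D <- ds | has (on_arch D) ls].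
  rewrite -filter_predI; apply: eq_filter => D /=; rewrite -/(on_arch D L).
  have [onL|] //= := boolP (on_arch D L); apply/esym/hasP => -[L' inL'].
  move/allP: pw => /(_ _ inL'); move: onL.
  case: L L' D {inL' in_right max_right eq_ls inL rem} => -[X a] Y [[X' a'] Y'] [x y].
  by rewrite /on_arch /on_line /=; lia.
case: fuel => [|fuel] le_sz; first by move: le_sz in_right; case: (rem).
rewrite (sigmasS _ _ _ in_right max_right) leftmost_reachable //= eq_rem.
congr (_ :: _).
  by have [-> ->] := label_arch inL; rewrite -addnS addKn.
apply: (IH (rcons pre L)); first by rewrite cat_rcons.
(* The right end of the line is itself removed, which pays for one unit of fuel. *)
rewrite -eq_rem size_filter -ltnS; apply: leq_trans le_sz.
rewrite -(count_predC (fun D => on_line (arch_right L) (arch_left L) D) rem).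
rewrite -[ltnLHS]add0n ltn_add2r -has_count; apply/hasP; exists (arch_right L) => //.
by rewrite /on_line /= eqxx leqnn andbT /=; lia.
Qed.

(** * The recursive form of phi *)

Definition perm_seq n (pi : 'S_n.+1) : seq nat :=
  [seq val (pi i) | i <- enum 'I_n.+1].

Lemma size_perm_seq n (pi : 'S_n.+1) : size (perm_seq pi) = n.+1.
Proof. by rewrite size_map size_enum_ord. Qed.

Lemma nth_perm_seq n (pi : 'S_n.+1) (i : 'I_n.+1) : nth 0 (perm_seq pi) i = pi i.
Proof.
by rewrite (nth_map i) ?nth_ord_enum // size_enum_ord.
Qed.

Lemma perm_seq_act_s n (pi : 'S_n.+1) s1 x y s2 :
    perm_seq pi = s1 ++ x :: y :: s2 ->
  perm_seq (act_s (size s1).+1 pi) = s1 ++ y :: x :: s2.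
Proof.
move=> eq_pi; have := size_perm_seq pi.
rewrite eq_pi size_cat /= => sz.
apply: (@eq_from_nth _ 0); rewrite size_perm_seq; first by rewrite size_cat /=.
move=> k lt_k; rewrite -[k]/(val (Ordinal lt_k)) nth_perm_seq /act_s permM.
rewrite -nth_perm_seq eq_pi permE /= -!val_eqE /= !inordK; try lia.
rewrite !nth_cat; have [->|neq1] := eqVneq k (size s1).
  by rewrite inordK; last lia; rewrite ltnn !ltnNge leqnSn subSnn subnn.
have [->|neq2] := eqVneq k (size s1).+1.
  by rewrite inordK; last lia; rewrite ltnn !ltnNge leqnSn subSnn subnn.
rewrite /=; case: ltnP => // le_k.
by rewrite (_ : k - size s1 = (k - (size s1).+2).+2); last lia.
Qed.

Lemma act_word_cat n w1 w2 (pi : 'S_n.+1) :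
  act_word (w1 ++ w2) pi = act_word w1 (act_word w2 pi).
Proof. exact: foldr_cat. Qed.

(** The smallest index acts first, so each transposition carries [x] one place further right. *)
Lemma perm_seq_act_word n (pi : 'S_n.+1) s1 x s2 s3 :
    perm_seq pi = s1 ++ x :: s2 ++ s3 ->
  perm_seq (act_word (rev (iota (size s1).+1 (size s2))) pi) =
    s1 ++ s2 ++ x :: s3.
Proof.
elim/last_ind: s2 s3 => [|s2 y IH] s3 //.
rewrite size_rcons -(addn1 (size s2)) iotaD rev_cat act_word_cat /= cat_rcons => eq_pi.
rewrite addSn -size_cat cat_rcons catA.
by apply: perm_seq_act_s; rewrite (IH (y :: s3)) // catA.
Qed.

(* The effect of the lines of a path of semilength m on m+1 consecutive entries;
   [take 1 v] stands for the singleton of the head of [v]. *)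
Fixpoint shuffle (T : Type) (t : spath) (w : seq T) : seq T :=
  match t with
  | Nil => w
  | Flat t => take 1 w ++ shuffle t (behead w)
  | Arch t1 t2 =>
      let v := shuffle t2 (drop (semilength t1) (behead w)) in
      shuffle t1 (take (semilength t1) (behead w) ++ take 1 v) ++
        take 1 w ++ behead v
  end.

Lemma shuffle_map (T T' : Type) (f : T -> T') t w :
  shuffle t (map f w) = map f (shuffle t w).
Proof.
elim: t w => [|t IH|t1 IH1 t2 IH2] w //=.
  by rewrite map_cat map_take -IH behead_map.
by rewrite !behead_map -!map_drop IH2 behead_map -!map_take -map_cat IH1 !map_cat.
Qed.

(** A shuffle only permutes positions. An arbitrary predicate on an arbitrary type covers sizes as
    well as disagreements in a zipped list. *)
Lemma count_shuffle (T : Type) (P : pred T) t w : count P (shuffle t w) = count P w.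
Proof.
have split1 v : count P v = count P (take 1 v) + count P (behead v).
  by case: v => //= x v; rewrite take0 addn0.
elim: t w => [|t IH|t1 IH1 t2 IH2] w //=.
  by rewrite count_cat IH -split1.
rewrite !(count_cat, IH1) [RHS]split1 -[behead w in RHS](cat_take_drop (semilength t1)).
rewrite count_cat -[count P (drop _ _)]IH2 [count P (shuffle _ _)]split1; lia.
Qed.

Lemma size_shuffle (T : Type) t (w : seq T) : size (shuffle t w) = size w.
Proof. by rewrite -!count_predT count_shuffle. Qed.

(** The first label available to a path starting at [(X, Y)] is [(X - Y)/2 + 1], so the path acts
    from position [size s1] on. Entering an arch preserves [X - Y]; passing a flat step or a whole
    arch lengthens [s1]. *)
Lemma perm_seq_arches n (pi : 'S_n.+1) t X Y s1 w s3 :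
    X = Y + (size s1).*2 -> size w = (semilength t).+1 ->
    perm_seq pi = s1 ++ w ++ s3 ->
  perm_seq (foldl (fun pi L => act_word (arch_word L) pi) pi (arches X Y t)) =
    s1 ++ shuffle t w ++ s3.
Proof.
elim: t pi X Y s1 w s3 => [|t IH|t1 IH1 t2 IH2] pi X Y s1 w s3 //= eqX.
  case: w => //= x w [sz] eq_pi; rewrite take0 -cat_rcons.
  by apply: IH; rewrite ?cat_rcons // size_rcons; lia.
case: w => //= x w [sz] eq_pi; rewrite take0 foldl_cat /=.
set a := semilength t1; set w1 := take a w; set w2 := drop a w.
have szw1 : size w1 = a by rewrite size_takel // sz /a; lia.
have szw2 : size w2 = (semilength t2).+1 by rewrite size_drop sz /a; lia.
have := IH2 pi (X + a.*2.+2) Y (s1 ++ x :: w1) w2 s3.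
rewrite size_cat /= szw1 -catA /= catA cat_take_drop => /(_ _ szw2 eq_pi).
have := size_shuffle t2 w2; rewrite szw2.
case: (shuffle t2 w2) => [|y v] //= _ eq_pi2; rewrite take0.
set pi2 := foldl _ _ _ in eq_pi2 *.
have {}eq_pi2 : perm_seq pi2 = s1 ++ x :: (w1 ++ [:: y]) ++ v ++ s3.
  by rewrite eq_pi2 ?catA //; [rewrite -!catA | lia].
rewrite -catA; apply: IH1 => //; rewrite ?size_cat ?szw1 /=; try lia.
rewrite -(perm_seq_act_word eq_pi2) /arch_word size_cat szw1 addn1.
by congr (perm_seq (act_word (rev (iota _ _)) _)); rewrite eqX /=; lia.
Qed.

Lemma perm_seq_decreasing n : perm_seq (decreasing_perm n) = rev (iota 0 n.+1).
Proof.
apply: (@eq_from_nth _ 0); rewrite size_perm_seq ?size_rev ?size_iota // => i lt_i.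
rewrite -[i]/(val (Ordinal lt_i)) nth_perm_seq permE.
by rewrite nth_rev size_iota // nth_iota /=; lia.
Qed.

Lemma act_word_arches n (ls : seq arch) (pi : 'S_n.+1) :
  act_word (flatten (rev (map arch_word ls))) pi =
  foldl (fun pi L => act_word (arch_word L) pi) pi ls.
Proof.
elim: ls pi => //= L ls IH pi.
by rewrite rev_cons flatten_rcons act_word_cat IH.
Qed.

Lemma perm_seq_phi t n : semilength t = n ->
  perm_seq (phi n (word t)) = shuffle t (rev (iota 0 n.+1)).
Proof.
move=> <-; rewrite /phi; set n' := semilength t; set ds := dots _ _.
have := @sigmas_arches t [::] (arches 0 0 t) (size ds) erefl.
have -> : [seq D <- dots (semilength t) (word t) | has (on_arch D) (arches 0 0 t)] = ds.
  by apply/all_filterP/allP => D; apply: dots_on_arch.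
move=> -> //; rewrite act_word_arches.
have := @perm_seq_arches n' (decreasing_perm n') t 0 0 [::] (rev (iota 0 n'.+1)) [::].
by rewrite !cats0; apply; rewrite ?size_rev ?size_iota // perm_seq_decreasing.
Qed.

(** * Neighbouring paths *)

Definition hdist (T : eqType) (s t : seq T) : nat :=
  count (fun ab => ab.1 != ab.2) (zip s t).

Lemma perm_diff_hdist n (pi rho : 'S_n.+1) :
  perm_diff pi rho = hdist (perm_seq pi) (perm_seq rho).
Proof.
rewrite /hdist /perm_seq zip_map count_map /perm_diff -sum1_card -sum1_count.
rewrite big_enum_cond; apply: eq_bigl => i.
by rewrite inE /= (inj_eq val_inj).
Qed.

Lemma hdist_refl (T : eqType) (s : seq T) : hdist s s = 0.
Proof. by rewrite /hdist; elim: s => //= x s ->; rewrite eqxx. Qed.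

Lemma hdistC (T : eqType) (s t : seq T) : hdist s t = hdist t s.
Proof.
rewrite /hdist; elim: s t => [|x s IH] [|y t] //=.
by rewrite IH eq_sym.
Qed.

Lemma hdist_cons (T : eqType) (x y : T) s t :
  hdist (x :: s) (y :: t) = (x != y) + hdist s t.
Proof. by []. Qed.

Lemma hdist_cat (T : eqType) (s1 s2 t1 t2 : seq T) : size s1 = size t1 ->
  hdist (s1 ++ s2) (t1 ++ t2) = hdist s1 t1 + hdist s2 t2.
Proof. by move=> sz; rewrite /hdist zip_cat // count_cat. Qed.

Lemma hdist_cat2l (T : eqType) (s s1 s2 : seq T) :
  hdist (s ++ s1) (s ++ s2) = hdist s1 s2.
Proof. by rewrite hdist_cat // hdist_refl. Qed.

Lemma hdist_map (T T' : eqType) (f : T -> T') s t :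
  hdist (map f s) (map f t) <= hdist s t.
Proof.
elim: s t => [|x s IH] [|y t] //=; rewrite !hdist_cons leq_add //.
by have [->|] := eqVneq x y; rewrite ?eqxx // leq_b1.
Qed.

(** The distance is a count over the zipped list, and by naturality shuffling the zip amounts to
    zipping the shuffles. *)
Lemma hdist_shuffle (T : eqType) t (u v : seq T) : size u = size v ->
  hdist (shuffle t u) (shuffle t v) = hdist u v.
Proof.
move=> sz; rewrite -[RHS](count_shuffle _ t) -[shuffle t (zip u v)]zip_unzip.
by rewrite /unzip1 /unzip2 -!shuffle_map -/unzip1 -/unzip2 unzip1_zip ?unzip2_zip ?sz.
Qed.

Lemma hdist_shuffle_uniq t t' (u w : seq nat) : size w = size u -> uniq u ->
  hdist (shuffle t w) (shuffle t' w) <= hdist (shuffle t u) (shuffle t' u).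
Proof.
(* A duplicate-free list maps onto any list of its size, and mapping creates no new
   disagreements. *)
move=> sz uniq_u; have -> : w = map (fun x => nth 0 w (index x u)) u.
  apply: (@eq_from_nth _ 0); rewrite ?size_map // sz => i lt_i.
  by rewrite (nth_map 0) // index_uniq.
by rewrite !shuffle_map hdist_map.
Qed.

(** All lists [w] are allowed, since inside an arch a subpath acts on entries already shuffled; by
    [hdist_shuffle_uniq] the decreasing permutation is the worst case. *)
Definition near n (t t' : spath) : Prop :=
  hdist (expand (word t)) (expand (word t')) <= 5 /\
  forall w : seq nat, size w = n.+1 -> hdist (shuffle t w) (shuffle t' w) <= 5.

Definition close n (p p' : path_word) : bool :=
  (path_diff p p' <= 5) && (perm_diff (phi n p) (phi n p') <= 5).

Lemma closeP n t t' : semilength t = n -> semilength t' = n ->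
  reflect (near n t t') (close n (word t) (word t')).
Proof.
move=> szt szt'; rewrite /close perm_diff_hdist !perm_seq_phi //.
apply: (iffP andP) => -[le_path le_perm]; split=> //.
  move=> w szw; apply: leq_trans le_perm; apply: hdist_shuffle_uniq.
    by rewrite szw size_rev size_iota.
  by rewrite rev_uniq iota_uniq.
by apply: le_perm; rewrite size_rev size_iota.
Qed.

Lemma closeC n p p' : close n p p' = close n p' p.
Proof.
rewrite /close !perm_diff_hdist hdistC; congr (_ && _).
by rewrite [path_diff _ _]hdistC.
Qed.

Lemma near_flat n t t' : near n t t' -> near n.+1 (Flat t) (Flat t').
Proof.
case=> le_path le_perm; split=> // -[|x w] //= [szw].
by rewrite take0 hdist_cons eqxx le_perm.
Qed.

Lemma shuffle_arch t1 t2 (T : Type) (x : T) w1 w2 : size w1 = semilength t1 ->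
  shuffle (Arch t1 t2) (x :: w1 ++ w2) =
  shuffle t1 (w1 ++ take 1 (shuffle t2 w2)) ++ x :: behead (shuffle t2 w2).
Proof. by move=> sz /=; rewrite take0 take_size_cat // drop_size_cat. Qed.

Lemma arch_split (T : Type) n a b (w : seq T) : size w = n.+1 -> n = (a + b).+1 ->
  exists x w1 w2, [/\ w = x :: w1 ++ w2, size w1 = a & size w2 = b.+1].
Proof.
case: w => [|x w] //= [szw] eq_n; exists x, (take a w), (drop a w).
by rewrite cat_take_drop size_takel ?size_drop ?szw; [split=> //; lia | lia].
Qed.

(** [t2] acts first and identically in both, so [t1] and [t1'] receive the same entries. *)
Lemma near_arch_l t1 t1' t2 : semilength t1 = semilength t1' ->
    near (semilength t1) t1 t1' ->
  near (semilength t1 + semilength t2).+1 (Arch t1 t2) (Arch t1' t2).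
Proof.
move=> sz1 [le_path le_perm]; split.
  rewrite !expand_arch hdist_cons hdist_cat ?size_expand_word ?sz1 //.
  by rewrite hdist_refl addn0.
move=> w /arch_split -/(_ _ _ erefl)[x [w1 [w2 [-> szw1 szw2]]]].
rewrite !shuffle_arch -?sz1 // hdist_cat ?size_shuffle // hdist_refl addn0.
have := size_shuffle t2 w2; rewrite szw2; case: (shuffle _ _) => //= y v _.
by apply: le_perm; rewrite take0 size_cat szw1 addn1.
Qed.

(** The only output of [t2] that reaches [t1] is its head, and [t1] then merely permutes positions,
    so no disagreement is gained or lost. *)
Lemma near_arch_r t1 t2 t2' : near (semilength t2) t2 t2' ->
  near (semilength t1 + semilength t2).+1 (Arch t1 t2) (Arch t1 t2').
Proof.
move=> [le_path le_perm]; split.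
  by rewrite !expand_arch hdist_cons hdist_cat2l hdist_cons !eqxx.
move=> w /arch_split -/(_ _ _ erefl)[x [w1 [w2 [-> szw1 szw2]]]].
have := le_perm _ szw2; rewrite !shuffle_arch //.
have := size_shuffle t2 w2; have := size_shuffle t2' w2; rewrite szw2.
case: (shuffle t2 w2) => //= y v; case: (shuffle t2' w2) => //= y' v' _ _.
rewrite !take0 hdist_cat ?size_shuffle ?size_cat // hdist_shuffle ?size_cat //.
by rewrite hdist_cat2l !hdist_cons eqxx addn0.
Qed.

Lemma near_flat_arch t : near (semilength t).+1 (Flat t) (Arch Nil t).
Proof.
split; first by rewrite expand_arch /= !hdist_cons hdist_refl.
case=> [|x w] //= [szw]; rewrite !take0 drop0.
have := size_shuffle t w; rewrite szw; case: (shuffle t w) => //= y v _.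
by rewrite take0 !hdist_cons hdist_refl; case: (x != y); case: (y != x).
Qed.

(** * First and last paths *)

Definition flats (m : nat) : spath := iter m Flat Nil.

(* The first ([c = false]) and the last ([c = true]) entry of S_m. *)
Definition extremal (c : bool) (m : nat) : spath :=
  if c then (if m is m'.+1 then Arch (flats m') Nil else Nil) else flats m.

Lemma semilength_flats m : semilength (flats m) = m.
Proof. by elim: m => //= m ->. Qed.

Lemma semilength_extremal c m : semilength (extremal c m) = m.
Proof.
by case: c m => [] [|m] //=; rewrite semilength_flats ?addn0.
Qed.

Lemma shuffle_flats (T : Type) m (w : seq T) : shuffle (flats m) w = w.
Proof. by elim: m w => //= m IH [|x w] //=; rewrite take0 IH. Qed.

Lemma shuffle_extremal (T : Type) c m (w : seq T) : size w = m.+1 ->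
  shuffle (extremal c m) w = if c then rot 1 w else w.
Proof.
case: c => [|_]; last exact: shuffle_flats.
case: m w => [|m] [|x w] // [szw]; first by case: w szw.
case/lastP: w szw => // w y; rewrite size_rcons => -[szw].
rewrite rot1_cons -(cats1 w y) shuffle_arch ?semilength_flats // shuffle_flats.
by rewrite /= cats1.
Qed.

Lemma expand_flats m : expand (word (flats m)) = nseq m.*2 LetR.
Proof.
elim: m => // m IH; rewrite doubleS.
by rewrite -[RHS]/[:: LetR, LetR & nseq m.*2 LetR] -IH.
Qed.

Lemma expand_extremal c m : expand (word (extremal c m.+1)) =
  if c then LetU :: nseq m.*2 LetR ++ [:: LetD] else [:: LetR, LetR & nseq m.*2 LetR].
Proof.
case: c; last exact: (expand_flats m.+1).
by rewrite [extremal _ _]/= expand_arch expand_flats.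
Qed.

Lemma cat_nseq_cons (T : Type) m (x : T) s : nseq m x ++ x :: s = x :: nseq m x ++ s.
Proof. by elim: m => //= m ->. Qed.

(** The constant 5 comes from here: with both paths of the last kind and [a], [b] positive, five
    letters differ, and so do five entries when those of [w] are distinct. *)
Lemma near_extremal c c' a b :
  near (a + b).+2 (Arch (extremal c a) (extremal c' b.+1))
                  (Arch (extremal c a.+1) (extremal c' b)).
Proof.
split.
  rewrite !expand_arch !expand_extremal hdist_cons.
  (* [expand_extremal] treats positive lengths only; this form includes [b = 0], where both kinds
     are empty. *)
  have eY (s : seq letter) : expand (word (extremal c' b)) = s ->
      s = if c' then (if b is b'.+1 then LetU :: nseq b'.*2 LetR ++ [:: LetD] else [::])
          else nseq b.*2 LetR.
    by move=> <-; case: c' b => [] [|b']; rewrite ?expand_extremal ?doubleS.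
  move: (expand (word (extremal c' b))) (eY _ erefl) => _ {eY} ->.
  case: c; last first.
    (* The two extra letters [r] are moved behind the run, exposing a common prefix. *)
    rewrite expand_flats /= -2!cat_nseq_cons hdist_cat2l.
    by case: c' b => [] [|b] //=; rewrite !hdist_cons hdist_refl.
  case: a => [|a]; last rewrite expand_extremal doubleS /= -!catA.
    by case: c' b => [] [|b] //=; rewrite !hdist_cons hdist_refl.
  rewrite hdist_cons -2!cat_nseq_cons hdist_cat2l.
  by case: c' b => [] [|b] //=; rewrite !hdist_cons hdist_refl.
have eq_n : (a + b).+2 = (a + b.+1).+1 by lia.
move=> w /arch_split -/(_ _ _ eq_n)[x [w1 [w2 [-> szw1 szw2]]]].
case: w2 szw2 => [|y [|z w2]] // [szw2].
rewrite (@shuffle_arch (extremal c a)) ?semilength_extremal //.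
(* The second arch is longer by one, so [y] passes from the part of the right path to that of the
   left one. *)
rewrite -(cat_rcons y) (@shuffle_arch (extremal c a.+1)); last first.
  by rewrite size_rcons szw1 semilength_extremal.
have eX m (v : seq nat) : size v = m -> forall u,
    shuffle (extremal c m) (v ++ [:: u]) =
      if c then rot 1 (v ++ [:: u]) else v ++ [:: u].
  by move=> szv u; apply: shuffle_extremal; rewrite size_cat szv addn1.
rewrite !(@shuffle_extremal _ c') /= ?szw2 //.
case: c'; rewrite ?rot1_cons /= ?take0.
  case: w2 szw2 => [|q w2] szw2 /=;
  rewrite ?rot1_cons /= ?take0 !eX ?size_rcons ?szw1 //.
    case: c {eX}; [case: w1 {szw1} => [|p w1]|];
    rewrite /= ?rot1_cons -?cats1 -?catA /= ?hdist_cat2l !hdist_cons /= hdist_refl; lia.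
  case: c {eX}; [case: w1 {szw1} => [|p w1]|];
  rewrite /= ?rot1_cons -?cats1 -?catA /= ?hdist_cat2l !hdist_cons /=;
  rewrite hdist_cat2l !hdist_cons hdist_refl; lia.
rewrite !eX ?size_rcons ?szw1 //.
case: c {eX}; [case: w1 {szw1} => [|p w1]|];
rewrite /= ?rot1_cons -?cats1 -?catA /= ?hdist_cat2l !hdist_cons /= hdist_refl; lia.
Qed.

Lemma close_flat n p p' : p \in schroder_list n -> p' \in schroder_list n ->
  close n p p' -> close n.+1 (StepE :: p) (StepE :: p').
Proof.
move=> /schroder_list_word[t szt <-] /schroder_list_word[t' szt' <-].
move/(closeP szt szt')/near_flat => near_t.
by apply/(@closeP _ (Flat t) (Flat t')) => //=; rewrite ?szt ?szt'.
Qed.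

Lemma close_arch_l a b p1 p1' p2 :
    p1 \in schroder_list a -> p1' \in schroder_list a -> p2 \in schroder_list b ->
  close a p1 p1' ->
  close (a + b).+1 (StepU :: p1 ++ StepD :: p2) (StepU :: p1' ++ StepD :: p2).
Proof.
move=> /schroder_list_word[t1 <- <-] /schroder_list_word[t1' szt1' <-].
move=> /schroder_list_word[t2 <- <-] /(closeP erefl szt1') near_t.
apply/(@closeP _ (Arch t1 t2) (Arch t1' t2)) => //=; first by rewrite szt1'.
exact: near_arch_l.
Qed.

Lemma close_arch_r a b p1 p2 p2' :
    p1 \in schroder_list a -> p2 \in schroder_list b -> p2' \in schroder_list b ->
  close b p2 p2' ->
  close (a + b).+1 (StepU :: p1 ++ StepD :: p2) (StepU :: p1 ++ StepD :: p2').
Proof.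
move=> /schroder_list_word[t1 <- <-] /schroder_list_word[t2 <- <-].
move=> /schroder_list_word[t2' szt2' <-] /(closeP erefl szt2') near_t.
apply/(@closeP _ (Arch t1 t2) (Arch t1 t2')) => //=; first by rewrite szt2'.
exact: near_arch_r.
Qed.

Lemma close_flat_arch n p : p \in schroder_list n ->
  close n.+1 (StepE :: p) (StepU :: StepD :: p).
Proof.
move=> /schroder_list_word[t <- <-].
exact/(@closeP _ (Flat t) (Arch Nil t))/near_flat_arch.
Qed.

Lemma close_extremal c c' a b :
  close (a + b).+2
    (StepU :: word (extremal c a) ++ StepD :: word (extremal c' b.+1))
    (StepU :: word (extremal c a.+1) ++ StepD :: word (extremal c' b)).
Proof.
apply/(@closeP _ (Arch (extremal c a) (extremal c' b.+1))
                (Arch (extremal c a.+1) (extremal c' b))).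
- by rewrite /= !semilength_extremal addnS.
- by rewrite /= !semilength_extremal.
exact: near_extremal.
Qed.

(** * Concatenated lists *)

Lemma sorted_cat (T : Type) (e : rel T) x0 s1 s2 : sorted e s1 -> sorted e s2 ->
    (0 < size s1 -> 0 < size s2 -> e (last x0 s1) (head x0 s2)) ->
  sorted e (s1 ++ s2).
Proof.
case: s1 => // x s1; case: s2 => [|y s2] /= e1 e2 e12; first by rewrite cats0.
by rewrite cat_path /= e1 e2 e12.
Qed.

Lemma flatten_iotaS (T : Type) (f : nat -> seq T) m :
  flatten [seq f i | i <- iota 1 m.+1] =
  flatten [seq f i | i <- iota 1 m] ++ f m.+1.
Proof. by rewrite -[m.+1]addn1 iotaD map_cat flatten_cat /= cats0 add1n addn1. Qed.

Lemma map_iotaS (T : Type) (f : nat -> T) m :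
  [seq f i | i <- iota 1 m.+1] = rcons [seq f i | i <- iota 1 m] (f m.+1).
Proof. by rewrite -[m.+1]addn1 iotaD map_cat cats1 add1n addn1. Qed.

Lemma last_flatten_iota (T : Type) (f : nat -> seq T) x0 m : 0 < m ->
  0 < size (f m) -> last x0 (flatten [seq f i | i <- iota 1 m]) = last x0 (f m).
Proof.
case: m => // m _; rewrite flatten_iotaS last_cat.
by case: (f m.+1).
Qed.

Lemma last_map_iota (T : Type) (f : nat -> T) x0 m : 0 < m ->
  last x0 [seq f i | i <- iota 1 m] = f m.
Proof. by case: m => // m _; rewrite map_iotaS last_rcons. Qed.

Lemma head_map_iota (T : Type) (f : nat -> T) x0 m : 0 < m ->
  head x0 [seq f i | i <- iota 1 m] = f 1.
Proof. by case: m. Qed.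

Lemma head_flatten_iota (T : Type) (f : nat -> seq T) x0 m : 0 < m ->
  0 < size (f 1) -> head x0 (flatten [seq f i | i <- iota 1 m]) = head x0 (f 1).
Proof. by case: m => //= m _; case: (f 1). Qed.

Lemma sorted_flatten_iota (T : Type) (e : rel T) x0 (f : nat -> seq T) m :
    (forall i, 0 < i <= m -> 0 < size (f i)) ->
    (forall i, 0 < i <= m -> sorted e (f i)) ->
    (forall i, 0 < i < m -> e (last x0 (f i)) (head x0 (f i.+1))) ->
  sorted e (flatten [seq f i | i <- iota 1 m]).
Proof.
elim: m => // m IH sz_f sorted_f step_f; rewrite flatten_iotaS.
apply: (@sorted_cat _ _ x0).
- by apply: IH => i le_im; [apply: sz_f | apply: sorted_f | apply: step_f]; lia.
- by apply: sorted_f; rewrite ltn0Sn leqnn.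
case: m {IH} sz_f step_f {sorted_f} => // m sz_f step_f _ _.
by rewrite last_flatten_iota ?step_f ?sz_f //; lia.
Qed.

Lemma sorted_map_iota (T : Type) (e : rel T) (f : nat -> T) m :
    (forall i, 0 < i < m -> e (f i) (f i.+1)) ->
  sorted e [seq f i | i <- iota 1 m].
Proof.
move=> step_f; rewrite -flatten_map1.
by apply: (@sorted_flatten_iota _ _ (f 0)) => // i; exact: step_f.
Qed.

Lemma schroder_gt0 n : 0 < schroder n.
Proof. by elim: n => // n IH; rewrite schroderS; lia. Qed.

Lemma offsetS i : 0 < i -> offset i.+1 = offset i + schroder i.-1.
Proof. by case: i => // i _; rewrite !offsetE /= big_nat_recr. Qed.

(** * The blocks of [schroder_list] and their boundaries *)

Definition arch_entry n i j k : path_word :=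
  StepU :: entry schroder_list i.-1 (n + i) j ++
  StepD :: entry schroder_list (n - i) (j + offset i + 1) k.

Definition arch_row n i j : seq path_word :=
  [seq arch_entry n i j k | k <- iota 1 (schroder (n - i))].

Definition arch_block n i : seq path_word :=
  flatten [seq arch_row n i j | j <- iota 1 (schroder i.-1)].

Lemma schroder_list_blocks n : schroder_list n.+1 =
  [seq StepE :: schroder_path_at n i | i <- iota 1 (schroder n)] ++
  flatten [seq arch_block n.+1 i | i <- iota 1 n.+1].
Proof. by rewrite schroder_listS. Qed.

Lemma size_arch_row n i j : 0 < size (arch_row n i j).
Proof. by rewrite size_map size_iota schroder_gt0. Qed.

Lemma size_arch_block n i : 0 < size (arch_block n i).
Proof.
rewrite /arch_block; case: (schroder i.-1) (schroder_gt0 i.-1) => // r _ /=.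
by rewrite size_cat addn_gt0 size_arch_row.
Qed.

Lemma last_arch_row n i j :
  last [::] (arch_row n i j) = arch_entry n i j (schroder (n - i)).
Proof. by rewrite last_map_iota ?schroder_gt0. Qed.

Lemma head_arch_row n i j : head [::] (arch_row n i j) = arch_entry n i j 1.
Proof. by rewrite head_map_iota ?schroder_gt0. Qed.

Lemma last_arch_block n i : last [::] (arch_block n i) =
  arch_entry n i (schroder i.-1) (schroder (n - i)).
Proof. by rewrite last_flatten_iota ?size_arch_row ?schroder_gt0 ?last_arch_row. Qed.

Lemma head_arch_block n i : head [::] (arch_block n i) = arch_entry n i 1 1.
Proof. by rewrite head_flatten_iota ?size_arch_row ?schroder_gt0 ?head_arch_row. Qed.

Lemma schroder_list_extremal n :
  schroder_path_at n 1 = word (extremal false n) /\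
  schroder_path_at n (schroder n) = word (extremal true n).
Proof.
have last_at m : schroder_path_at m (schroder m) = last [::] (schroder_list m).
  by rewrite -nth_last size_schroder_list.
elim: n => // n [IH _]; split.
  rewrite /schroder_path_at schroder_list_blocks.
  case: (schroder n) (schroder_gt0 n) => //= r _.
  by rewrite -IH.
rewrite last_at schroder_list_blocks last_cat.
rewrite last_flatten_iota ?size_arch_block // -[LHS]/(last _ _).
have := last_arch_block n.+1 n.+1.
case: (arch_block _ _) (size_arch_block n.+1 n.+1) => //= p s _ ->.
(* In the last block the superscript is even, so the inner list is read backwards and ends with its
   first path, a run of flat steps. *)
rewrite /arch_entry subnn /entry addnn odd_double /= addKn.
by move: IH; rewrite /schroder_path_at /= => ->; case: odd.
Qed.

Lemma entry_first m i :
  entry schroder_list m i 1 = word (extremal (~~ odd i) m).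
Proof.
have [first_m last_m] := schroder_list_extremal m.
by rewrite /entry; case: odd; rewrite ?addnK.
Qed.

Lemma entry_last m i :
  entry schroder_list m i (schroder m) = word (extremal (odd i) m).
Proof.
have [first_m last_m] := schroder_list_extremal m.
by rewrite /entry; case: odd; rewrite ?addKn.
Qed.

(** Reading a list backwards only reverses its neighbouring pairs, and closeness is symmetric. *)
Lemma entry_close m i j :
    (forall q, 0 < q < schroder m ->
       close m (schroder_path_at m q) (schroder_path_at m q.+1)) ->
    0 < j < schroder m ->
  close m (entry schroder_list m i j) (entry schroder_list m i j.+1).
Proof.
rewrite /entry => close_m lt_j; case: odd; first exact: (close_m j).
have := close_m (schroder m + 1 - j.+1); rewrite closeC /schroder_path_at.
rewrite (_ : (schroder m + 1 - j.+1).+1 = schroder m + 1 - j); last lia.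
by apply; lia.
Qed.

Lemma schroder_list_close n q : 0 < q < schroder n ->
  close n (schroder_path_at n q) (schroder_path_at n q.+1).
Proof.
elim/ltn_ind: n q => -[|n] IH q; first by case: q => [|[]].
(* [sorted] relates consecutive entries only, so the claim splits along the concatenations. *)
suffices sorted_n : sorted (close n.+1) (schroder_list n.+1).
  case: q => // q /andP[_ lt_q].
  by have /(sortedP [::]) := sorted_n; apply; rewrite size_schroder_list.
rewrite schroder_list_blocks; apply: (@sorted_cat _ _ [::]).
- apply: sorted_map_iota => i lt_i; apply: close_flat; last exact: IH.
    by apply: schroder_path_at_in; lia.
  by apply: schroder_path_at_in; lia.
- apply: (@sorted_flatten_iota _ _ [::]) => i le_i.
  + exact: size_arch_block.
  + have eq_n : n.+1 = (i.-1 + (n.+1 - i)).+1 by lia.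
    apply: (@sorted_flatten_iota _ _ [::]) => j le_j.
    * exact: size_arch_row.
    * apply: sorted_map_iota => k lt_k; rewrite [X in close X]eq_n.
      apply: close_arch_r; try (apply: entry_in; lia).
      by apply: entry_close lt_k => q'; apply: IH; lia.
    (* From [j] to [j.+1] the superscript of the right list changes parity: the next row starts with
       the right path that ended this one. *)
    rewrite last_arch_row head_arch_row [X in close X]eq_n /arch_entry.
    rewrite entry_last entry_first !addSn /= negbK -entry_last.
    apply: close_arch_l; try (apply: entry_in; rewrite ?schroder_gt0 ?leqnn; lia).
    by apply: entry_close le_j => q'; apply: IH; lia.
  (* From block [i] to [i.+1] both superscripts change parity, the right one because [offset] grows
     by the number of rows. So the last paths of one block and the first paths of the next are of
     the same kinds [c] and [c']. *)
  rewrite last_arch_block head_arch_block /arch_entry offsetS; last lia.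
  rewrite !entry_last !entry_first; set c := odd (n.+1 + i).
  set c' := odd (schroder i.-1 + offset i + 1).
  rewrite (_ : ~~ odd (n.+1 + i.+1) = c); last by rewrite /c; lia.
  rewrite (_ : ~~ odd (1 + _ + 1) = c'); last by rewrite /c'; lia.
  have := close_extremal c c' i.-1 (n - i).
  rewrite prednK; last lia.
  rewrite -subSn; last lia.
  by rewrite (_ : (i.-1 + (n - i)).+2 = n.+1); last lia.
move=> _ _; rewrite last_map_iota ?schroder_gt0 //.
rewrite head_flatten_iota ?size_arch_block //.
(* The first right superscript is 2, so that list is read backwards and starts with the path [p] on
   which the flat block ended: the transition is from [e p] to [u d p]. *)
rewrite head_arch_block /arch_entry !entry_first subn1 /=.
rewrite (_ : word (extremal _ 0) = [::]); last by case: odd.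
have [_ <-] := schroder_list_extremal n.
by apply: close_flat_arch; apply: schroder_path_at_in; rewrite schroder_gt0 /=.
Qed.

Theorem theorem3p4 (n q : nat) (hq : 1 <= q) (hqr : q < schroder n) :
  path_diff (schroder_path_at n q) (schroder_path_at n q.+1) <= 5 /\
  perm_diff (Phi n q) (Phi n q.+1) <= 5.
Proof. by apply/andP; apply: schroder_list_close; rewrite hq. Qed.
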